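(* Let $f:\mathbb{R}\to\mathbb{R}$ be a non-negative function such that \[ \sum_{k\in\mathbb{Z}}f(\xi+k)=\sum_{j\in\mathbb{Z}}f(2^j\xi)=1\qquad\text{for a.e. }\xi\in\mathbb{R}. \] Then there exists a set $G\subset\operatorname{supp}(f)$ such that \[ \sum_{k\in\mathbb{Z}}\mathbf{1}_G(\xi+k)=\sum_{j\in\mathbb{Z}}\mathbf{1}_G(2^j\xi)=1\qquad\text{for a.e. }\xi\in\mathbb{R}. \]
   Context: Here $f$ is defined at every point of $\mathbb{R}$ and is not assumed to be measurable. The set $G$ is not required to be measurable. $\operatorname{supp}(f)=\{\xi\in\mathbb{R}: f(\xi)\neq 0\}$, and $\mathbf{1}_G$ is the indicator function of $G$. ''For a.e. $\xi$'' means for all $\xi$ outside some set of Lebesgue measure zero. *)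

(* Defs.v *)
From mathcomp Require Import all_boot all_order all_algebra.
From mathcomp Require Import all_classical all_reals all_analysis.

Set Implicit Arguments.
Unset Strict Implicit.
Unset Printing Implicit Defensive.

Import Order.TTheory GRing.Theory Num.Theory.

Local Open Scope classical_set_scope.
Local Open Scope ring_scope.
Local Open Scope ereal_scope.

(* Not the closure: supp(f) is the set of points where f does not vanish. *)
Definition supp (R : realType) (f : R -> R) : set R :=
  [set xi | f xi <> 0%R].

(* [esum] is the unconditional sum in [\bar R]; it is used here for
   nonnegative g only, where it is the usual sum of the series. *)
Definition translation_sum (R : realType) (g : R -> R) (xi : R) : \bar R :=
  \esum_(k in [set: int]) (g (xi + k%:~R)%R)%:E.

Definition dilation_sum (R : realType) (g : R -> R) (xi : R) : \bar R :=
  \esum_(j in [set: int]) (g ((2 : R) ^ j * xi)%R)%:E.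

(* Main.v *)
(* View the points of R as the edges of a bipartite graph joining the
   translation class x + Z to the dilation class 2^Z x: the function f is a
   doubly stochastic weight on the edges, and G is a perfect matching inside
   its support. Outside a null set invariant under both actions, each orbit of
   the group they generate is a countable graph. Keeping finitely many edges
   in the i-th row, with total weight at least 1 - 2^-(i+1), preserves the Hall
   condition, because cardinalities are integers; hence there are matchings
   covering all rows and, symmetrically, all columns, and a Cantor-Bernstein
   argument merges the two. *)
Require Import Defs.
From mathcomp Require Import all_boot all_order all_algebra finmap.
From mathcomp Require Import all_classical all_reals all_analysis measurable_realfun ring.

Set Implicit Arguments.
Unset Strict Implicit.
Unset Printing Implicit Defensive.

Import Order.TTheory GRing.Theory Num.Theory.

Local Open Scope classical_set_scope.
Local Open Scope ring_scope.

(** * Hall's theorem for countably many finite sets *)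

Section Hall.
Variables (I V : choiceType) (D : set I).
Implicit Types (S T : I -> {fset V}) (A B : {fset I}).

Definition hall S := forall A, [set` A] `<=` D ->
  (#|` A| <= #|` \bigcup_(i <- A) S i|)%fset%N.

Definition restrict_at S i (X : {fset V}) : I -> {fset V} :=
  fun j => if j == i then X else S j.

Lemma bigfcup_restrict_notin S i X A : i \notin A ->
  (\bigcup_(j <- A) restrict_at S i X j = \bigcup_(j <- A) S j)%fset.
Proof.
move=> iA; apply: eq_big_seq => j jA; rewrite /restrict_at ifN//.
by apply: contraNneq iA => <-.
Qed.

Lemma bigfcup_restrict_in S i X A : i \in A ->
  (\bigcup_(j <- A) restrict_at S i X j =
   X `|` \bigcup_(j <- A `\ i) S j)%fset.
Proof.
move=> iA; rewrite (big_fsetD1 i iA)/= {1}/restrict_at eqxx.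
by rewrite bigfcup_restrict_notin// !inE eqxx.
Qed.

(** A set violating the Hall condition must contain [i], because nothing changed elsewhere; deleting
    [i] from it weakens the strict inequality to a non-strict one. *)
Lemma hall_restrictN S i X : hall S -> D i -> ~ hall (restrict_at S i X) ->
  exists A, [/\ [set` A] `<=` D, i \notin A &
    (#|` X `|` \bigcup_(j <- A) S j| <= #|` A|)%fset%N].
Proof.
move=> hS Di /existsNP[A] /not_implyP[AD /negP]; rewrite -ltnNge => ltA.
have [iA|iA] := boolP (i \in A); last first.
  by move: ltA; rewrite bigfcup_restrict_notin// ltnNge hS.
exists (A `\ i)%fset; split.
- by move=> j /=; rewrite !inE => /andP[_ jA]; exact: AD.
- by rewrite !inE eqxx.
- by rewrite -bigfcup_restrict_in// -ltnS (leq_trans ltA)// (cardfsD1 i A) iA.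
Qed.

(* Submodularity of the neighbourhood size: if neither x nor y could be
   dropped from S i, two tight sets A and B would witness it, and then their
   union and intersection would violate the Hall condition. *)
Lemma hall_drop S i x y : hall S -> D i -> x \in S i -> y \in S i -> x != y ->
  hall (restrict_at S i (S i `\ x)%fset) \/
  hall (restrict_at S i (S i `\ y)%fset).
Proof.
move=> hS Di xS yS xy; apply: contrapT => /not_orP[Nx Ny].
have [A [AD iA leA]] := hall_restrictN hS Di Nx.
have [B [BD iB leB]] := hall_restrictN hS Di Ny.
set U := fun A => (\bigcup_(j <- A) S j)%fset in leA leB.
have U1 : (#|` A `|` B|.+1 <=
    #|` (S i `\ x `|` U A) `|` (S i `\ y `|` U B)|)%fset%N.
  have iAB : i \notin (A `|` B)%fset by rewrite inE negb_or iA.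
  have := hS (i |` (A `|` B))%fset; rewrite cardfsU1 iAB add1n => /(_ _)/leq_trans.
  apply; first by move=> j /=; rewrite !inE => /orP[/eqP->//|/orP[/AD|/BD]].
  apply: fsubset_leq_card; apply/fsubsetP => z /bigfcupP[j].
  rewrite andbT !inE => /orP[/eqP-> zj|/orP[] jAB zj].
  - have [->|zx] := eqVneq z x; last by rewrite zj.
    by rewrite xy xS !orbT.
  - by apply/orP; left; apply/orP; right; apply/bigfcupP; exists j; rewrite ?jAB.
  - by apply/orP; right; apply/orP; right; apply/bigfcupP; exists j; rewrite ?jAB.
have U2 : (#|` A `&` B| <=
    #|` (S i `\ x `|` U A) `&` (S i `\ y `|` U B)|)%fset%N.
  have := hS (A `&` B)%fset => /(_ _)/leq_trans; apply.
    by move=> j /=; rewrite !inE => /andP[/AD].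
  apply: fsubset_leq_card; apply/fsubsetP => z /bigfcupP[j].
  rewrite andbT !inE => /andP[jA jB] zj; apply/andP; split; apply/orP; right;
    by apply/bigfcupP; exists j; rewrite ?jA ?jB.
have := leq_add U1 U2; rewrite cardfsUI addSn cardfsUI.
by move=> /leq_trans/(_ (leq_add leA leB)); rewrite ltnn.
Qed.

Lemma hall_neq0 S i : hall S -> D i -> S i != fset0.
Proof.
move=> hS Di; have := hS [fset i]%fset; rewrite cardfs1 big_seq_fset1 cardfs_gt0.
by apply=> j /=; rewrite inE => /eqP->.
Qed.

(** While [S i] has two elements, [hall_drop] discards one of them; the Hall condition for the
    single index [i] keeps the set nonempty. *)
Lemma hall_shrink S i : hall S -> D i ->
  exists2 T, hall T & (exists y, T i = [fset y]%fset) /\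
    forall j, (T j `<=` S j)%fset.
Proof.
elim: {S}_.+1 {-2}S (ltnSn #|` S i|) => // m IH S; rewrite ltnS => leS hS Di.
have /fset0Pn[x xS] := hall_neq0 hS Di.
have [Sx|] := eqVneq (S i `\ x)%fset fset0.
  exists S => //; split=> //; exists x; apply/fsetP => z; rewrite inE.
  apply/idP/eqP => [zS|->//]; apply/eqP; rewrite -[_ == _]negbK; apply/negP => zx.
  by have := in_fset0 z; rewrite -Sx !inE zx zS.
move=> /fset0Pn[y]; rewrite !inE => /andP[yx yS].
have [z zS hz] : exists2 z, z \in S i & hall (restrict_at S i (S i `\ z)%fset).
  have [h|h] := hall_drop hS Di yS xS yx; first by exists y.
  by exists x.
have [|T hT [T1 TS]] := IH _ _ hz Di.
  by rewrite /restrict_at eqxx (leq_trans _ leS)// (cardfsD1 z (S i)) zS.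
exists T => //; split=> // j; apply: fsubset_trans (TS j) _.
by rewrite /restrict_at; case: eqP => [->|//]; exact: fsubD1set.
Qed.

(** The indices are treated one after another, each set being shrunk to a singleton while the Hall
    condition survives. The value [v0] only fills in [g] outside [D]. *)
Lemma hall_matching S (v0 : V) : countable D -> hall S ->
  exists g : I -> V, (forall i, D i -> g i \in S i) /\ {in D &, injective g}.
Proof.
move=> /countable_injP[n n_inj] hS.
have step (kS : nat * (I -> {fset V})) : exists T, hall kS.2 -> [/\ hall T,
    forall i, D i -> n i = kS.1 -> exists y, T i = [fset y]%fset &
    forall j, (T j `<=` kS.2 j)%fset].
  case: kS => k S' /=; have [hS'|] := pselect (hall S'); last by exists S'.
  have [[i [Di nik]]|noi] := pselect (exists i, D i /\ n i = k).
    have [T hT [T1 TS]] := hall_shrink hS' Di; exists T => _; split=> // j Dj njk.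
    by have -> : j = i by apply: n_inj; rewrite ?inE// njk.
  exists S' => _; split=> // i Di nik; by exfalso; apply: noi; exists i.
have [G GP] := choice step.
(* Stage [k.+1] settles the index numbered [k], if there is one; the sets only decrease from stage
   to stage. *)
pose fix F k := if k is k'.+1 then G (k', F k') else S.
have hF k : hall (F k).
  by elim: k => [|k IH]; [exact: hS|case: (GP (k, F k) IH)].
have FS k j : (F k.+1 j `<=` F k j)%fset.
  by have [_ _ /(_ j)] := GP (k, F k) (hF k).
have Fle k l j : (k <= l)%N -> (F l j `<=` F k j)%fset.
  move=> /subnK <-; elim: (l - k)%N => //= m IH.
  exact: fsubset_trans (FS _ _) IH.
have F1 i : exists y, D i -> F (n i).+1 i = [fset y]%fset.
  have [Di|NDi] := pselect (D i); last by exists v0.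
  by have [_ /(_ i Di erefl)[y yE] _] := GP (n i, F (n i)) (hF _); exists y.
have [g gP] := choice F1.
(* A singleton can no longer shrink, since later stages remain nonempty. *)
have Fg i k : D i -> (n i < k)%N -> F k i = [fset g i]%fset.
  move=> Di ik; have := Fle _ _ i ik; rewrite gP// fsubset1 => /orP[/eqP//|].
  by rewrite (negbTE (hall_neq0 (hF k) Di)).
exists g; split=> [i Di|i j].
  by have /fsubsetP := Fle 0%N (n i).+1 i (leq0n _); rewrite gP//; apply; rewrite inE.
rewrite !inE => Di Dj gij; apply/eqP; apply: contraT => ij.
(* By stage [k] both indices are settled; a common value would give the pair a union of size 1,
   against the Hall condition. *)
pose k := (maxn (n i) (n j)).+1.
have := hF k [fset i; j]%fset; rewrite cardfs2 ij big_fsetU1 ?inE// big_seq_fset1.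
rewrite !Fg ?ltnS ?leq_maxl ?leq_maxr// gij/= fsetUid cardfs1; apply.
by move=> l /=; rewrite !inE => /orP[]/eqP->.
Qed.
End Hall.

(** * From unit row and column sums to a matching covering all rows *)

(** Distinct exponents make this part of a finite geometric sum [1 - 2^-m]. Strictness is what later
    allows rounding to integers. *)
Lemma sum_half_powers_lt1 (R : realFieldType) (T : choiceType) (n : T -> nat)
    (A : {fset T}) : {in A &, injective n} ->
  \sum_(t <- A) 2^-1 ^+ (n t).+1 < 1 :> R.
Proof.
move=> n_inj; have half0 : 0 <= 2^-1 :> R by rewrite invr_ge0.
have -> : \sum_(t <- A) 2^-1 ^+ (n t).+1 =
    \sum_(k <- (n @` A)%fset) 2^-1 ^+ k.+1 :> R by rewrite big_imfset.
move: (n @` A)%fset => B.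
have [m Bm] : exists m, forall k, k \in B -> (k < m)%N.
  exists (\max_(k <- B) k).+1 => k kB; rewrite ltnS.
  by rewrite (big_fsetD1 k kB)/= leq_maxl.
have geom : \sum_(k < m) 2^-1 ^+ k.+1 = 1 - 2^-1 ^+ m :> R.
  elim: m {Bm} => [|m IH]; first by rewrite big_ord0 expr0 subrr.
  by rewrite big_ord_recr/= IH exprS; field.
apply: (@le_lt_trans _ _ (\sum_(k < m) 2^-1 ^+ k.+1)); last first.
  by rewrite geom gtrBl exprn_gt0// invr_gt0.
have -> : \sum_(k <- B) 2^-1 ^+ k.+1 =
    \sum_(k <- [seq k <- iota 0 m | k \in B]) 2^-1 ^+ k.+1 :> R.
  apply: perm_big; apply: uniq_perm; rewrite ?fset_uniq ?filter_uniq ?iota_uniq//.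
  move=> k; rewrite mem_filter mem_iota add0n.
  by have [/Bm->|] := boolP (k \in B).
have -> : \sum_(k < m) 2^-1 ^+ k.+1 = \sum_(k <- iota 0 m) 2^-1 ^+ k.+1 :> R.
  by rewrite -[m in iota 0 m]subn0 -/(index_iota 0 m) big_mkord.
rewrite big_filter big_mkcond/=.
by apply: ler_sum => k _; case: ifP => // _; rewrite exprn_ge0.
Qed.

Section row_covering_matching.
Variables (R : realType) (E T U : choiceType).
Implicit Types (C M : set E) (r : E -> T) (c : E -> U) (f : E -> R).

Lemma fsum_le_esum C f (Z : {fset E}) : (forall e, 0 <= f e) ->
  [set` Z] `<=` C -> ((\sum_(e <- Z) f e)%:E <= \esum_(e in C) (f e)%:E)%E.
Proof.
move=> f0 ZC; apply: esum_ge; exists [set` Z]; first by split.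
by rewrite fsbig_finite//= set_fsetK sumEFin.
Qed.

(** A finite set nearly attains the supremum defining the sum; removing the zeros of [f] from it
    costs no mass and leaves only edges in the support. *)
Lemma esum_approx C f (e : R) : (forall x, 0 <= f x) -> 0 < e ->
  \esum_(x in C) (f x)%:E = 1%:E ->
  exists2 Z : {fset E}, [set` Z] `<=` C `&` [set x | f x <> 0] &
    1 - e <= \sum_(x <- Z) f x.
Proof.
move=> f0 e0 sum1.
have : ((1 - e)%:E < \esum_(x in C) (f x)%:E)%E by rewrite sum1 lte_fin gtrBl.
move=> /ereal_sup_gt[_ [X [finX XC] <-]].
rewrite fsbig_finite//= sumEFin lte_fin => /ltW le.
exists [fset x in fset_set X | f x != 0]%fset.
  move=> x /=; rewrite !inE in_fset_set// => /andP[/set_mem/XC Cx /eqP fx].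
  by split.
apply: le_trans le _; rewrite le_eqVlt; apply/orP; left; apply/eqP.
rewrite -big_fset_condE/= [LHS]big_mkcond [RHS]big_mkcond/=.
by rewrite [RHS]big_mkcond/=; apply: eq_bigr => x _; case: eqVneq.
Qed.

(* Selecting finitely many edges in each row i loses at most 2^-(i+1) of its
   unit mass, so a finite set A of rows keeps mass > #|A| - 1, which the
   columns it reaches can only absorb if there are at least #|A| of them. *)
Lemma row_covering_matching C r c f : countable C -> (forall e, 0 <= f e) ->
  (forall e, C e ->
     \esum_(e' in C `&` [set e' | r e' = r e]) (f e')%:E = 1%:E) ->
  (forall e, C e ->
     \esum_(e' in C `&` [set e' | c e' = c e]) (f e')%:E = 1%:E) ->
  exists M, [/\ M `<=` C `&` [set e | f e <> 0],
    {in M &, injective r}, {in M &, injective c} &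
    forall e, C e -> exists2 e', M e' & r e' = r e].
Proof.
move=> Ccount f0 rows cols.
have [[e0 Ce0]|C0] := pselect (exists e, C e); last first.
  exists set0; split=> [|e e'|e e'|e Ce] //; rewrite ?inE//.
  by exfalso; apply: C0; exists e.
pose D := r @` C.
have Dcount : countable D by apply: sub_countable Ccount; exact: card_image_le.
have /countable_injP[n n_inj] := Dcount.
have F_ex t : exists Z : {fset E},
    [set` Z] `<=` C `&` [set e | r e = t] `&` [set e | f e <> 0] /\
    (D t -> 1 - 2^-1 ^+ (n t).+1 <= \sum_(e <- Z) f e).
  have [[e Ce <-]|NDt] := pselect (D t); last first.
    by exists fset0; split=> // x /=; rewrite inE.
  have eps0 : 0 < 2^-1 ^+ (n (r e)).+1 :> R by rewrite exprn_gt0// invr_gt0.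
  have [Z ZC leZ] := esum_approx f0 eps0 (rows e Ce).
  by exists Z.
have [F FP] := choice F_ex.
have FC t e : e \in F t -> [/\ C e, r e = t & f e <> 0].
  by move=> eF; have [/(_ e eF)[[]]] := FP t.
have hallF : hall D (fun t => c @` F t)%fset.
  move=> A AD; set V := (\bigcup_(t <- A) _)%fset.
  pose Z := (\bigcup_(t <- A) F t)%fset.
  have ZC e : e \in Z -> C e.
    by move=> /bigfcupP[t _ /FC[]].
  (* The mass of [Z] is counted twice: by rows here, by columns in [sumZ2]. *)
  have sumZ1 : \sum_(e <- Z) f e = \sum_(t <- A) \sum_(e <- F t) f e.
    apply: partition_disjoint_bigfcup => s t _ _ st.
    apply/fdisjointP => e /FC[_ re _]; apply/negP => /FC[_ re' _].
    by move: st; rewrite -re -re' eqxx.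
  have sumZ2 : \sum_(e <- Z) f e =
      \sum_(u <- V) \sum_(e <- [fset e in Z | c e == u]%fset) f e.
    rewrite -partition_disjoint_bigfcup; last first.
      move=> u v _ _ uv; apply/fdisjointP => e; rewrite !inE => /andP[_ /eqP->].
      by rewrite negb_and uv orbT.
    congr bigop; congr enum_fset; apply/fsetP => e; apply/idP/bigfcupP.
      move=> eZ; exists (c e); last by rewrite !inE eZ eqxx.
      have /bigfcupP[t tA eF] := eZ; rewrite andbT; apply/bigfcupP.
      by exists t => //; apply/imfsetP; exists e.
    by move=> [u _]; rewrite !inE => /andP[].
  (* The part of [Z] in one column is a finite piece of a column of total mass 1. *)
  have leV : \sum_(e <- Z) f e <= #|` V|%:R.
    rewrite sumZ2 -sum1_size natr_sum; apply: ler_sum => u _ /=.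
    set Y := [fset _ in _ | _]%fset.
    have [->|/fset0Pn[e eY]] := eqVneq Y fset0; first by rewrite big_seq_fset0.
    have eP x : x \in Y -> C x /\ c x = u.
      by rewrite !inE => /andP[/ZC ? /eqP].
    have [Ce ceu] := eP e eY.
    rewrite -lee_fin -(cols e Ce); apply: fsum_le_esum => // x /eP[Cx cx].
    by split=> //=; rewrite cx.
  have : #|` A|%:R - 1 < #|` V|%:R :> R.
    apply: lt_le_trans leV; rewrite sumZ1.
    apply: (@lt_le_trans _ _ (\sum_(t <- A) (1 - 2^-1 ^+ (n t).+1))).
      have {1}-> : #|` A|%:R = \sum_(t <- A) 1 :> R by rewrite -sum1_size natr_sum.
      rewrite sumrB ltrD2l ltrN2 sum_half_powers_lt1//.
      by move=> s t /AD sD /AD tD; apply: n_inj; rewrite inE.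
    rewrite [leLHS]big_seq [leRHS]big_seq; apply: ler_sum => t /AD Dt.
    by have [_ /(_ Dt)] := FP t.
  by rewrite ltrBlDr natr1 ltr_nat ltnS.
have [g [gF g_inj]] := hall_matching (c e0) Dcount hallF.
(* Hall's theorem only yields a column [g t] for each row; [h t] is a selected edge joining the
   two. *)
have h_ex t : exists e, D t -> [/\ e \in F t & c e = g t].
  have [Dt|NDt] := pselect (D t); last by exists e0.
  by have /imfsetP[e /= eF ge] := gF t Dt; exists e.
have [h hP] := choice h_ex.
have hM t : D t -> [/\ C (h t), f (h t) <> 0, r (h t) = t & c (h t) = g t].
  by move=> /hP[/FC[]].
exists (h @` D); split.
- by move=> _ [t /hM[] ? ? ? ? <-].
- by move=> _ _ /[!inE] -[s /hM[_ _ rs _] <-] [t /hM[_ _ rt _] <-]; rewrite rs rt => ->.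
- move=> _ _ /[!inE] -[s Ds <-] [t Dt <-].
  have [_ _ _ ->] := hM s Ds; have [_ _ _ ->] := hM t Dt.
  by move=> /g_inj -> //; rewrite inE.
- move=> e Ce; have De : D (r e) by exists e.
  by exists (h (r e)); [exists (r e)|have [] := hM _ De].
Qed.
End row_covering_matching.

(* Cantor-Bernstein / Mendelsohn-Dulmage: along the alternating paths that
   start in a row missed by M2, use M1; elsewhere use M2. *)
Section perfect_matching.
Variables (E T U : Type) (r : E -> T) (c : E -> U) (C M1 M2 : set E).

Inductive alternating : T -> Prop :=
| alternating_start t : ~ (r @` M2) t -> alternating t
| alternating_step e1 e2 : M1 e1 -> alternating (r e1) -> M2 e2 ->
    c e2 = c e1 -> alternating (r e2).

Lemma merge_matchings : M1 `<=` C -> M2 `<=` C ->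
  {in M1 &, injective r} -> {in M1 &, injective c} ->
  {in M2 &, injective r} -> {in M2 &, injective c} ->
  (forall e, C e -> exists2 e', M1 e' & r e' = r e) ->
  (forall e, C e -> exists2 e', M2 e' & c e' = c e) ->
  exists M, [/\ M `<=` M1 `|` M2,
    {in M &, injective r}, {in M &, injective c},
    forall e, C e -> exists2 e', M e' & r e' = r e &
    forall e, C e -> exists2 e', M e' & c e' = c e].
Proof.
move=> M1C M2C r1 c1 r2 c2 row1 col2.
exists [set e | M1 e /\ alternating (r e) \/ M2 e /\ ~ alternating (r e)]; split.
- by move=> e [[]|[]]; [left|right].
- move=> e e' /[!inE] -[[Me ae]|[Me ae]] [[Me' ae']|[Me' ae']] re.
  + by apply: r1; rewrite ?inE.
  + by exfalso; apply: ae'; rewrite -re.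
  + by exfalso; apply: ae; rewrite re.
  + by apply: r2; rewrite ?inE.
- move=> e e' /[!inE] -[[Me ae]|[Me ae]] [[Me' ae']|[Me' ae']] ce.
  + by apply: c1; rewrite ?inE.
  (* An [M1] edge on an alternating path pulls the [M2] edge of the same column onto it, so the two
     parts share no column. *)
  + by exfalso; apply: ae'; exact: alternating_step Me ae Me' (esym ce).
  + by exfalso; apply: ae; exact: alternating_step Me' ae' Me ce.
  + by apply: c2; rewrite ?inE.
- move=> e Ce; have [ae|ae] := pselect (alternating (r e)).
    by have [e' Me' re'] := row1 e Ce; exists e' => //; left; rewrite re'.
  have [[e' Me' re']|ne] := pselect ((r @` M2) (r e)).
    by exists e' => //; right; rewrite re'.
  by exfalso; apply: ae; exact: alternating_start.
- move=> e /col2[e2 Me2 ce2]; rewrite -ce2.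
  have [ae2|ae2] := pselect (alternating (r e2)); last by exists e2 => //; right.
  (* The row of [e2] is met by [M2], so it is not a starting row. It was reached through an [M2]
     edge, necessarily [e2], and the preceding [M1] edge covers the same column. *)
  move re2E : (r e2) ae2 => t ae2.
  case: ae2 re2E => [s ns re2|e1 e2' Me1 ae1 Me2' ce].
    by exfalso; apply: ns; exists e2.
  move=> /r2 -> //; rewrite ?inE//.
  by exists e1 => //; left.
Qed.
End perfect_matching.

(** * Null sets and orbits under integer translations and dyadic dilations *)

Section affine_orbits.
Variable R : realType.
Implicit Types (x y : R) (N : set R) (w : seq (int * int)).
Local Notation mu := (@lebesgue_measure R).

(** The right-hand side is a scaled pushforward measure that has the correct value on half-open
    intervals, so uniqueness of Lebesgue measure applies. *)
Lemma lebesgue_measure_affine (a b : R) (A : set R) : 0 < a -> measurable A ->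
  mu A = (a%:E * mu ((fun x => (a * (x + b))%R) @^-1` A))%E.
Proof.
move=> a0 mA; pose h x : measurableTypeR R := a * (x + b).
have mh : measurable_fun [set: measurableTypeR R] h.
  by apply: measurable_funM => //; exact: measurable_funD.
have a0' : 0 <= a by exact: ltW.
apply: (@lebesgue_measure_unique R (mscale (NngNum a0') (pushforward mu h))) => //.
move=> _ [[u v] _ <-] /=.
have hE : h @^-1` `]u, v]%classic = `]a^-1 * u - b, a^-1 * v - b]%classic.
  apply/seteqP; split=> x /=; rewrite !in_itv/= ltrBlDr lerBrDr;
  by rewrite ltr_pdivrMl// ler_pdivlMl.
transitivity (a%:E * mu (h @^-1` `]u, v]%classic))%E; last by [].
rewrite hE.
rewrite !lebesgue_measure_itv/= !lte_fin ltrD2r ltr_pM2l ?invr_gt0//.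
case: ifP => _; last by rewrite mule0.
by rewrite -!EFinB -EFinM; congr EFin; field; rewrite gt_eqF.
Qed.

Lemma negligible_affine_preimage (a b : R) N : 0 < a -> mu.-negligible N ->
  mu.-negligible ((fun x => a * (x + b)) @^-1` N).
Proof.
move=> a0 [A [mA A0 NA]]; exists ((fun x => a * (x + b)) @^-1` A); split.
- rewrite -[X in measurable X]setTI; apply: measurable_funM => //.
  exact: measurable_funD.
- have /esym/eqP := lebesgue_measure_affine b a0 mA; rewrite A0 mule_eq0.
  by rewrite eqe gt_eqF//= => /eqP.
- by move=> x /= /NA.
Qed.

(** Words of integer pairs stand for the elements of the generated group; they form a countable
    type, which makes orbits countable. *)
Definition act w x := foldr (fun kj y => (2 : R) ^ kj.2 * (y + kj.1%:~R)) x w.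

Definition orbit x : set R := range (act^~ x).

Lemma act_cat w1 w2 x : act (w1 ++ w2) x = act w1 (act w2 x).
Proof. by rewrite /act foldr_cat. Qed.

Lemma act_inv w x : exists w', act w' (act w x) = x.
Proof.
elim: w => [|[k j] w [w' w'K]]; first by exists [::].
(* The rightmost letter acts first: the dilation is undone, then the translation. *)
exists (w' ++ [:: (- k, 0); (0, - j)]); rewrite act_cat /= addr0 expr0z mul1r.
rewrite mulrA -expfzDr ?pnatr_eq0// addNr expr0z mul1r rmorphN addrK.
exact: w'K.
Qed.

Lemma orbit_refl x : orbit x x.
Proof. by exists [::]. Qed.

Lemma orbit_eq x y : orbit x y -> orbit y = orbit x.
Proof.
move=> [w _ <-]; apply/seteqP; split=> z [w1 _ <-].
  by exists (w1 ++ w) => //; rewrite act_cat.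
have [w' w'K] := act_inv w x.
by exists (w1 ++ w') => //; rewrite act_cat w'K.
Qed.

Lemma orbit_translate x (k : int) : orbit x (x + k%:~R).
Proof. by exists [:: (k, 0)] => //=; rewrite expr0z mul1r. Qed.

Lemma orbit_dilate x (j : int) : orbit x (2 ^ j * x).
Proof. by exists [:: (0, j)] => //=; rewrite addr0. Qed.

Lemma countable_orbit x : countable (orbit x).
Proof. by apply: sub_countable (card_image_le _ _) _. Qed.

Lemma negligible_act_preimage w N : mu.-negligible N ->
  mu.-negligible (act w @^-1` N).
Proof.
elim: w N => [|[k j] w IH] N N0; first exact: N0.
apply: (IH ((fun y => 2 ^ j * (y + k%:~R)) @^-1` N)).
by apply: negligible_affine_preimage => //; rewrite exprz_gt0.
Qed.

(** The saturation is the union of the preimages of [N] under the countably many words, numbered by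
    [pickle]. *)
Lemma negligible_saturation N : mu.-negligible N ->
  mu.-negligible [set x | exists2 y, orbit x y & N y].
Proof.
move=> N0; pose F n := if choice.unpickle n is Some w then act w @^-1` N else set0.
apply: (@negligibleS _ (measurableTypeR R) _ mu (\bigcup_n F n)).
  move=> x [_ [w _ <-] Nwx]; exists (choice.pickle w) => //.
  by rewrite /F choice.pickleK.
apply: negligible_bigcup => n; rewrite /F; case: choice.unpickle => [w|].
  exact: negligible_act_preimage.
exact: negligible_set0.
Qed.

(** Classes are kept as sets so that [row] and [column] can serve as the vertex maps [r] and [c]. *)
Definition row x : set R := [set x + k%:~R | k in [set: int]].
Definition column x : set R := [set 2 ^ j * x | j in [set: int]].

Lemma row_refl x : row x x.
Proof. by exists 0 => //; rewrite addr0. Qed.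

Lemma row_eq x y : row x y <-> row y = row x.
Proof.
split=> [[k _ <-]|<-]; last exact: row_refl.
apply/seteqP; split=> _ [l _ <-].
  by exists (k + l) => //; rewrite intrD addrA.
by exists (l - k) => //; rewrite intrD rmorphN addrA addrAC addrK.
Qed.

Lemma column_refl x : column x x.
Proof. by exists 0 => //; rewrite expr0z mul1r. Qed.

Lemma column_eq x y : column x y <-> column y = column x.
Proof.
split=> [[j _ <-]|<-]; last exact: column_refl.
apply/seteqP; split=> _ [l _ <-].
  by exists (l + j) => //; rewrite expfzDr ?pnatr_eq0// mulrA.
by exists (l - j) => //; rewrite mulrA -expfzDr ?pnatr_eq0// subrK.
Qed.

Lemma row_sub_orbit x : row x `<=` orbit x.
Proof. by move=> _ [k _ <-]; exact: orbit_translate. Qed.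

Lemma column_sub_orbit x : column x `<=` orbit x.
Proof. by move=> _ [k _ <-]; exact: orbit_dilate. Qed.

Lemma translation_sum_row (g : R -> R) x :
  translation_sum g x = (\esum_(y in row x) (g y)%:E)%E.
Proof.
rewrite (@reindex_esum _ _ _ [set: int] (row x) (fun k => x + k%:~R))//.
split=> [k _|k l _ _ /addrI/intr_inj//|_ [k _ <-]]; by exists k.
Qed.

(** For [x != 0] the dilates of [x] are distinct, so summing over exponents or over points is the
    same; at 0 they all coincide. *)
Lemma dilation_sum_column (g : R -> R) x : x != 0 ->
  dilation_sum g x = (\esum_(y in column x) (g y)%:E)%E.
Proof.
move=> x0.
rewrite (@reindex_esum _ _ _ [set: int] (column x) (fun j => 2 ^ j * x))//.
split=> [k _|k l _ _ /(mulIf x0)|_ [k _ <-]]; [by exists k| |by exists k].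
by apply: ieexprIz; rewrite ?gt_eqF ?ltr1n.
Qed.

Lemma esum_indic_unique (S G : set R) y0 : S y0 -> G y0 ->
  (forall y, S y -> G y -> y = y0) -> (\esum_(y in S) (\1_G y : R)%:E = 1)%E.
Proof.
move=> Sy0 Gy0 uniq_y0.
rewrite -[RHS](@esum_set1 R R y0 (fun=> 1%E))// esum_mkcond [RHS]esum_mkcond.
apply: eq_esum => y _; rewrite indicE; have [->|yy0] := eqVneq y y0.
  by rewrite !mem_set.
rewrite [y \in [set y0]]memNset; last exact/eqP.
case: ifPn => // /set_mem Sy; rewrite memNset// => Gy.
by move/eqP: yy0; apply; exact: uniq_y0.
Qed.

End affine_orbits.

(** * Gluing perfect matchings of the good orbits *)

Theorem theorem3p3 (R : realType) (f : R -> R)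
  (f_ge0 : forall xi : R, 0 <= f xi)
  (f_sums : {ae (@lebesgue_measure R), forall xi : R,
     translation_sum f xi = 1%:E /\ dilation_sum f xi = 1%:E}) :
  exists G : set R,
    G `<=` supp f /\
    {ae (@lebesgue_measure R), forall xi : R,
       translation_sum \1_G xi = 1%:E /\ dilation_sum \1_G xi = 1%:E}.
Proof.
(* The point 0 is discarded because [dilation_sum_column] fails there. *)
pose N := ~` [set x | translation_sum f x = 1%:E /\ dilation_sum f x = 1%:E]
  `|` [set 0].
pose bad := [set x | exists2 y, orbit x y & N y].
have bad0 : (@lebesgue_measure R).-negligible bad.
  apply: negligible_saturation; apply: negligibleU; first exact: f_sums.
  by apply/negligibleP; [exact: measurable_set1|exact: lebesgue_measure_set1].
have good x y : ~ bad x -> orbit x y ->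
    [/\ y != 0, translation_sum f y = 1%:E & dilation_sum f y = 1%:E].
  move=> xgood xy; have Ny : ~ N y by move=> Ny; apply: xgood; exists y.
  have [ty dy] : translation_sum f y = 1%:E /\ dilation_sum f y = 1%:E.
    by apply: contrapT => sy; apply: Ny; left.
  by split=> //; apply/eqP => y0; apply: Ny; right.
(* The matching is chosen from the orbit as a set, not from a point, so that all points of an orbit
   get the same one. *)
have G_ex (O : set R) : exists M : set R, forall x, ~ bad x -> O = orbit x ->
    [/\ M `<=` O `&` supp f, {in M &, injective (@row R)},
      {in M &, injective (@column R)},
      forall y, O y -> exists2 y', M y' & row y' = row y &
      forall y, O y -> exists2 y', M y' & column y' = column y].
  have [[x [xgood ->]]|noO] := pselect (exists x, ~ bad x /\ O = orbit x);
    last first.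
    by exists set0 => x xgood Ox; exfalso; apply: noO; exists x.
  have orow y : orbit x y -> orbit x `&` [set y' | row y' = row y] = row y.
    move=> xy; apply/seteqP; split=> z /=; first by case=> _ /row_eq.
    move=> yz; split; last exact/row_eq.
    by rewrite -(orbit_eq xy); exact: row_sub_orbit.
  have ocol y : orbit x y ->
      orbit x `&` [set y' | column y' = column y] = column y.
    move=> xy; apply/seteqP; split=> z /=; first by case=> _ /column_eq.
    move=> yz; split; last exact/column_eq.
    by rewrite -(orbit_eq xy); exact: column_sub_orbit.
  have rows y : orbit x y ->
      (\esum_(z in orbit x `&` [set y' | row y' = row y]) (f z)%:E = 1%:E)%E.
    move=> xy; rewrite orow// -translation_sum_row.
    by have [] := good x y xgood xy.
  have cols y : orbit x y ->
      (\esum_(z in orbit x `&` [set y' | column y' = column y]) (f z)%:E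
       = 1%:E)%E.
    move=> xy; have [y0 _ dy] := good x y xgood xy.
    by rewrite ocol// -dilation_sum_column.
  have [M1 [M1C r1 c1 row1]] :=
    row_covering_matching (countable_orbit x) f_ge0 rows cols.
  (* The same lemma with rows and columns exchanged. *)
  have [M2 [M2C c2 r2 col2]] :=
    row_covering_matching (countable_orbit x) f_ge0 cols rows.
  have [||M [MM rM cM rowM colM]] := merge_matchings _ _ r1 c1 r2 c2 row1 col2.
  - by move=> y /M1C[].
  - by move=> y /M2C[].
  exists M => _ _ _; split=> // y /MM[/M1C|/M2C]; exact.
have [m mP] := choice G_ex.
pose G := [set x | ~ bad x /\ m (orbit x) x].
(* On a good orbit, [G] is exactly the matching chosen for it. *)
have mG x y : ~ bad x -> orbit x y -> G y <-> m (orbit x) y.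
  move=> xgood xy; rewrite /G/= (orbit_eq xy); split=> [[]//|my]; split=> //.
  move=> [z yz Nz]; apply: xgood; exists z => //; by rewrite -(orbit_eq xy).
exists G; split=> [x [xgood mx]|].
  by have [/(_ x mx)[]] := mP _ x xgood erefl.
apply: negligibleS bad0 => x; apply: contra_notP => xgood /=.
have [MO rM cM rowM colM] := mP _ x xgood erefl.
have [x0 _ _] := good x x xgood (orbit_refl x).
rewrite translation_sum_row dilation_sum_column//; split.
- have [y my ry] := rowM x (orbit_refl x); have xy := (MO y my).1.
  apply: (@esum_indic_unique _ _ _ y); [exact/row_eq|exact/(mG x y xgood xy)|].
  move=> z xz /(mG x z xgood (row_sub_orbit xz)) mz.
  by apply: rM; rewrite ?inE// ry; exact/row_eq.
- have [y my cy] := colM x (orbit_refl x); have xy := (MO y my).1.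
  apply: (@esum_indic_unique _ _ _ y); [exact/column_eq|exact/(mG x y xgood xy)|].
  move=> z xz /(mG x z xgood (column_sub_orbit xz)) mz.
  by apply: cM; rewrite ?inE// cy; exact/column_eq.
Qed.
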